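(* Let $0\le r\le n$, let $D\in\mathrm{Diff}^{(q,a)}(\widetilde\Omega)$, and let $\alpha,\beta$ be functions defining an action $\cdot_D$ of $S$ on $\widetilde\Omega$ satisfying conditions (a), (b), (c) of the context, with resulting module $\Omega_D$ and $\Omega^r_D=\bigoplus_{b\ge n_r}\Omega^r_D(b)$, where $n_r>n$. If for every $b\ge n_r$ we have $$\alpha(r,b,1)^2-\beta(r,b,1)^2\ne0,$$ then the $S$-module $\Omega^r_D$ is finitely generated by elements of degree $n_r$.
   Context: Let $S=\mathbb C[x_1,\dots,x_n]$ and let $\Omega=\bigoplus_{r\ge0}\Omega^r$ be the exterior algebra of (Kähler) differential forms of $S$ over $\mathbb C$. Each $\Omega^r$ is graded, $\Omega^r=\bigoplus_{b\ge0}\Omega^r(b)$, with each $x_i$ and each $dx_i$ of degree $1$; $S(c)$ is the space of homogeneous polynomials of degree $c$. $d$ is the exterior differential, $R=\sum_i x_i\frac{\partial}{\partial x_i}$ is the radial vector field, and $i_R$ is contraction with $R$. $\widetilde\Omega=\bigoplus_{r\ge0,\ b\ge n_r}\Omega^r(b)$, for some $n_r\in\mathbb N$, is a truncation of $\Omega$ in low degrees. A linear map $\varphi$ has degree $q$ if it maps $r$-forms to $(r+q)$-forms; for linear maps $\varphi,\psi$ of degrees $q,s$ put $[\varphi,\psi]=\varphi\psi-(-1)^{qs}\psi\varphi$; $\lambda_\mu$ denotes left multiplication by $\mu$. A differential operator (of order 1) of degree $q$ is a $\mathbb C$-linear map $D$ of degree $q$ with $[[D,\lambda_\mu],\lambda_\tau]=0$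 for all forms $\mu,\tau$. It has bidegree $(q,a)$ if it maps $\Omega^r(b)$ to $\Omega^{r+q}(b+a)$. $\mathrm{Diff}^{(q,a)}(\widetilde\Omega)$ denotes the set of such operators of bidegree $(q,a)$ on $\widetilde\Omega$. Given $D\in\mathrm{Diff}^{(q,a)}(\widetilde\Omega)$, one considers actions of $S$ on $\widetilde\Omega$ of the form $$f\cdot_D\tau=\alpha(r,b,c)\,f\tau+\beta(r,b,c)\,df\wedge i_R\tau\qquad(f\in S(c),\ \tau\in\Omega^r(b)),$$ extended additively, where $\alpha,\beta$ are $\mathbb C$-valued functions of $(r,b,c)$ such that: (a) $\alpha(r,b,0)=1$ for all $r,b$; (b) $D(f\cdot_D\tau)=f\cdot_D D(\tau)$; (c) $(gf)\cdot_D\tau=g\cdot_D(f\cdot_D\tau)$. $\Omega_D$ denotes $\widetilde\Omega$ equipped with this $S$-module structure (same underlying $\mathbb C$-vector space and grading), and $\Omega^r_D$ its part of form degree $r$, with homogeneous components $\Omega^r_D(b)=\Omega^r(b)$, $b\ge n_r$.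
   Formalization: For r = 0 it is additionally assumed that β(0,b,1) = 0 for b ≥ n_0; since i_R vanishes on 0-forms, β(0,·,·) does not affect the action, and without this normalization the r = 0 case fails (e.g. D = 0, α(r,b,c) = 0 for c > 0, β(0,b,c) = 1). *)

(* Defs.v *)
From HB Require Import structures.
From mathcomp Require Import all_boot all_order all_algebra.
From mathcomp Require Import reals.
From mathcomp Require Import complex mpoly.

Set Implicit Arguments.
Unset Strict Implicit.
Unset Printing Implicit Defensive.

Import Order.TTheory GRing.Theory Num.Theory.

Local Open Scope ring_scope.
Local Open Scope complex_scope.

(* [R[i]] is the field of complex numbers over the real numbers [R].
   Omega is the free S-module on the dx_I = dx_{i_1} /\ ... /\ dx_{i_r},
   I = {i_1 < ... < i_r}; a form is the family of its coefficients. *)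
Definition diff_form (R : realType) (n : nat) : Type :=
  {ffun {set 'I_n} -> {mpoly R[i][n]}}.

Section Forms.
Variables (R : realType) (n : nat).
Local Notation S := {mpoly R[i][n]}.
Local Notation Omega := (diff_form R n).

Definition form0 (f : S) : Omega := [ffun I => f *+ (I == set0)].

Definition dx (i : 'I_n) : Omega := [ffun I => (I == [set i])%:R].

Definition scale_form (f : S) (w : Omega) : Omega := [ffun I => f * w I].

Definition inversions (I J : {set 'I_n}) : nat :=
  #|[set p : 'I_n * 'I_n | [&& p.1 \in I, p.2 \in J & (p.2 < p.1)%N]]|.

(* dx_I /\ dx_J = (-1)^(inversions I J) dx_(I u J) if I and J are disjoint,
   and 0 otherwise. *)
Definition wedge (u v : Omega) : Omega :=
  [ffun K : {set 'I_n} => \sum_(I : {set 'I_n} | I \subset K)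
     (-1) ^+ inversions I (K :\: I) * (u I * v (K :\: I))].

Definition ext_d (w : Omega) : Omega :=
  \sum_(i < n) wedge (dx i) [ffun I => (w I)^`M(i)].

(* Contraction with the vector field \sum_k (X k) d/dx_k:
   i_X (dx_(k_1) /\ ... /\ dx_(k_r)) is the sum over p of
   (-1)^(p-1) X_(k_p) dx_(k_1) /\ ... (omit dx_(k_p)) ... /\ dx_(k_r). *)
Definition contract (X : 'I_n -> S) (w : Omega) : Omega :=
  [ffun I : {set 'I_n} => \sum_(k < n | k \notin I)
     (-1) ^+ #|[set j in I | (j < k)%N]| * (X k * w (k |: I))].

Definition radial (i : 'I_n) : S := 'X_i.

(* Omega^r *)
Definition is_rform (r : nat) (w : Omega) : Prop :=
  forall I : {set 'I_n}, w I != 0 -> #|I| = r.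

(* Omega^r(b); since dx_i has degree 1, the monomial x^m dx_I has degree
   |m| + |I|.  The indices are integers so that they can be shifted by an
   arbitrary bidegree: the component is 0 when an index is negative. *)
Definition bihomog (r b : int) (w : Omega) : Prop :=
  forall (I : {set 'I_n}) (m : 'X_{1..n}), (w I)@_m != 0 ->
    #|I|%:Z = r /\ (mdeg m + #|I|)%N%:Z = b.

(* the truncation \bigoplus_(r, b >= nr r) Omega^r(b) *)
Definition trunc (nr : nat -> nat) (w : Omega) : Prop :=
  forall (I : {set 'I_n}) (m : 'X_{1..n}), (w I)@_m != 0 ->
    (nr #|I| <= mdeg m + #|I|)%N.

(* the bracket of operators of degrees q and s *)
Definition gcomm (q s : int) (phi psi : Omega -> Omega) : Omega -> Omega :=
  fun w => phi (psi w) - ((-1 : R[i]) ^ (q * s)) *: psi (phi w).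

(* Operators on the truncation are represented by functions on Omega of which
   only the values on the truncation are constrained.  The truncation need not
   be stable under left multiplication by all forms, so the order 1 condition
   is required wherever every multiplication that D is composed with stays in
   the truncation.  By bilinearity of the bracket, it is enough to take forms
   that are homogeneous for the form degree. *)
Record is_Diff (nr : nat -> nat) (q a : int) (D : Omega -> Omega) : Prop := {
  Diff_trunc : forall w, trunc nr w -> trunc nr (D w);
  Diff_linear : forall (k : R[i]) v w, trunc nr v -> trunc nr w ->
    D (k *: v + w) = k *: D v + D w;
  Diff_bidegree : forall (r b : nat) w, (nr r <= b)%N ->
    bihomog r b w -> bihomog (r%:Z + q) (b%:Z + a) (D w);
  Diff_order1 : forall (s t : nat) (mu tau w : Omega),
    is_rform s mu -> is_rform t tau ->
    trunc nr w -> trunc nr (wedge mu w) -> trunc nr (wedge tau w) ->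
    trunc nr (wedge mu (wedge tau w)) ->
    gcomm (q + s%:Z) t (gcomm q s D (wedge mu)) (wedge tau) w = 0
}.

(* the component of w in Omega^r(b) *)
Definition bicomp (r b : nat) (w : Omega) : Omega :=
  [ffun I : {set 'I_n} => if (#|I| == r) && (r <= b)%N
    then pihomog mdeg (b - r) (w I) else 0].

(* all the nonzero components of w have degree b < deg_bound w *)
Definition deg_bound (w : Omega) : nat :=
  \max_(I : {set 'I_n}) (msize (w I) + #|I|)%N.

(* For r = 0 the contraction vanishes, so [be 0 b c] does not affect the action.
   A condition on it is meaningful only after normalizing it, to 0: otherwise
   alpha^2 - beta^2 <> 0 would not prevent [al 0 b c] from vanishing. *)
Definition act_term (al be : nat -> nat -> nat -> R[i])
    (r b c : nat) (f : S) (w : Omega) : Omega :=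
  al r b c *: scale_form f w
  + be r b c *: wedge (ext_d (form0 f)) (contract radial w).

Definition form_act (al be : nat -> nat -> nat -> R[i])
    (f : S) (w : Omega) : Omega :=
  \sum_(c < msize f) \sum_(r < n.+1) \sum_(b < deg_bound w)
    act_term al be r b c (pihomog mdeg c f) (bicomp r b w).

Record is_action (nr : nat -> nat) (D : Omega -> Omega)
    (al be : nat -> nat -> nat -> R[i]) : Prop := {
  action_a : forall r b, al r b 0%N = 1;
  action_b : forall f w, trunc nr w ->
    D (form_act al be f w) = form_act al be f (D w);
  action_c : forall f g w, trunc nr w ->
    form_act al be (g * f) w = form_act al be g (form_act al be f w)
}.

(* M, with the action of S given by ac, is generated by finitely many
   elements of the subset G of M. *)
Definition finitely_generated_in (ac : S -> Omega -> Omega)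
    (M G : Omega -> Prop) : Prop :=
  exists (m : nat) (g : 'I_m -> Omega),
    (forall i, G (g i)) /\
    (forall w, M w -> exists f : 'I_m -> S, w = \sum_(i < m) ac (f i) (g i)).

(* [form_act] is the biadditive extension of [act_term]: [form_act_homog],
   [form_actDl] and [form_actDr] characterize it. *)

Lemma scale_formDl f g w :
  scale_form (f + g) w = scale_form f w + scale_form g w.
Proof. by apply/ffunP => I; rewrite !ffunE mulrDl. Qed.

Lemma scale_formDr f v w :
  scale_form f (v + w) = scale_form f v + scale_form f w.
Proof. by apply/ffunP => I; rewrite !ffunE mulrDr. Qed.

Lemma wedgeDl u v w : wedge (u + v) w = wedge u w + wedge v w.
Proof.
apply/ffunP => K; rewrite !ffunE -big_split /=; apply: eq_bigr => I _.
by rewrite ffunE mulrDl mulrDr.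
Qed.

Lemma wedgeDr u v w : wedge u (v + w) = wedge u v + wedge u w.
Proof.
apply/ffunP => K; rewrite !ffunE -big_split /=; apply: eq_bigr => I _.
by rewrite ffunE !mulrDr.
Qed.

Lemma form0D f g : form0 (f + g) = form0 f + form0 g.
Proof. by apply/ffunP => I; rewrite !ffunE mulrnDl. Qed.

Lemma ext_dD v w : ext_d (v + w) = ext_d v + ext_d w.
Proof.
rewrite /ext_d -big_split /=; apply: eq_bigr => i _; rewrite -wedgeDr.
by congr (wedge _ _); apply/ffunP => I; rewrite !ffunE mderivD.
Qed.

Lemma contractD X v w : contract X (v + w) = contract X v + contract X w.
Proof.
apply/ffunP => K; rewrite !ffunE -big_split /=; apply: eq_bigr => I _.
by rewrite ffunE !mulrDr.
Qed.

Lemma bicompD r b v w : bicomp r b (v + w) = bicomp r b v + bicomp r b w.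
Proof.
apply/ffunP => I; rewrite !ffunE; case: ifP => _; last by rewrite addr0.
by rewrite pihomogD.
Qed.

Lemma bicomp0 r b : bicomp r b 0 = 0.
Proof. by apply: (addrI (bicomp r b 0)); rewrite -bicompD !addr0. Qed.

Lemma act_termDl al be r b c f g w :
  act_term al be r b c (f + g) w
  = act_term al be r b c f w + act_term al be r b c g w.
Proof.
rewrite /act_term scale_formDl form0D ext_dD wedgeDl scalerDr scalerDr.
exact: addrACA.
Qed.

Lemma act_termDr al be r b c f v w :
  act_term al be r b c f (v + w)
  = act_term al be r b c f v + act_term al be r b c f w.
Proof.
rewrite /act_term scale_formDr contractD wedgeDr scalerDr scalerDr.
exact: addrACA.
Qed.

Lemma act_term0l al be r b c w : act_term al be r b c 0 w = 0.
Proof. by apply: (addrI (act_term al be r b c 0 w)); rewrite -act_termDl !addr0. Qed.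

Lemma act_term0r al be r b c f : act_term al be r b c f 0 = 0.
Proof. by apply: (addrI (act_term al be r b c f 0)); rewrite -act_termDr !addr0. Qed.

Lemma pihomog_big c (f : S) : (msize f <= c)%N -> pihomog mdeg c f = 0.
Proof.
move=> le_f_c; rewrite pihomogE big_seq_cond big1 // => m /andP[mf /eqP mc].
by move: (msize_mdeg_lt mf); rewrite mc ltnNge le_f_c.
Qed.

Lemma bicomp_big r b w : (deg_bound w <= b)%N -> bicomp r b w = 0.
Proof.
move=> le_w_b; apply/ffunP => I; rewrite !ffunE.
case: ifP => // /andP[/eqP cI le_r_b]; apply: pihomog_big.
rewrite leq_subRL // addnC -cI; apply: leq_trans le_w_b.
exact: (@leq_bigmax _ (fun J : {set 'I_n} => msize (w J) + #|J|)%N I).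
Qed.

Lemma form_actwE al be f w p q : (msize f <= p)%N -> (deg_bound w <= q)%N ->
  form_act al be f w = \sum_(c < p) \sum_(r < n.+1) \sum_(b < q)
    act_term al be r b c (pihomog mdeg c f) (bicomp r b w).
Proof.
move=> le_f_p le_w_q; pose F c (r : 'I_n.+1) b :=
  act_term al be r b c (pihomog mdeg c f) (bicomp r b w).
have wideb c r : \sum_(b < deg_bound w) F c r b = \sum_(b < q) F c r b.
  rewrite (big_ord_widen _ (F c r) le_w_q) big_mkcond /=.
  apply: eq_bigr => b _; case: ltnP => // le_w_b.
  by rewrite /F bicomp_big // act_term0r.
pose G c := \sum_(r < n.+1) \sum_(b < q) F c r b.
transitivity (\sum_(c < msize f) G c).
  by apply: eq_bigr => c _; apply: eq_bigr => r _; exact: wideb.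
rewrite (big_ord_widen _ G le_f_p) big_mkcond /=.
apply: eq_bigr => c _; case: ltnP => // le_f_c.
rewrite /G big1 // => r _; rewrite big1 // => b _.
by rewrite /F pihomog_big // act_term0l.
Qed.

Lemma form_actDl al be f g w :
  form_act al be (f + g) w = form_act al be f w + form_act al be g w.
Proof.
pose p := maxn (msize (f + g)) (maxn (msize f) (msize g)).
rewrite !(@form_actwE _ _ _ _ p (deg_bound w)) ?leq_max ?leqnn ?orbT //.
do 3!(rewrite -big_split /=; apply: eq_bigr => ? _).
by rewrite pihomogD act_termDl.
Qed.

Lemma form_actDr al be f v w :
  form_act al be f (v + w) = form_act al be f v + form_act al be f w.
Proof.
pose p := maxn (deg_bound (v + w)) (maxn (deg_bound v) (deg_bound w)).
rewrite !(@form_actwE _ _ _ _ (msize f) p) ?leq_max ?leqnn ?orbT //.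
do 3!(rewrite -big_split /=; apply: eq_bigr => ? _).
by rewrite bicompD act_termDr.
Qed.

Lemma bicomp_homog (r b r' b' : nat) w : bihomog r b w ->
  bicomp r' b' w = if (r == r') && (b == b') then w else 0.
Proof.
move=> w_rb; apply/ffunP => I; rewrite !ffunE.
have [wI0|wI_neq0] := eqVneq (w I) 0.
  rewrite wI0 pihomog0 if_same.
  by case: ifP => _; rewrite ?wI0 ?ffunE.
have wE m : (w I)@_m != 0 -> #|I| = r /\ (mdeg m + #|I|)%N = b.
  by move=> /w_rb[[->] [->]].
have [cI /esym leb] : #|I| = r /\ (mdeg (mlead (w I)) + #|I|)%N = b.
  by apply: wE; rewrite mleadc_eq0.
rewrite cI; case: eqP => //= [<-|_]; last by rewrite ffunE.
have w_homog : w I \is (b - r).-homog.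
  apply/dhomogP => m; rewrite mcoeff_msupp => /wE[_ <-].
  by rewrite cI addnK.
have le_r_b : (r <= b)%N by rewrite leb cI leq_addl.
case: eqP => [<-|neq_b]; first by rewrite le_r_b pihomog_dE.
rewrite ffunE; case: ifP => // le_r_b'; apply: pihomog_ne0 w_homog.
by apply/eqP => /(congr1 (addn r)); rewrite !subnKC.
Qed.

Lemma sum_ord_only (V : nmodType) (F : nat -> V) (m k : nat) : (k < m)%N ->
  (forall i, i != k -> F i = 0) -> \sum_(i < m) F i = F k.
Proof.
move=> lt_k F0; rewrite (bigD1 (Ordinal lt_k)) //= big1 ?addr0 // => i neq_i.
exact: F0.
Qed.

Lemma form_act_homog al be (r b c : nat) f w :
  f \is c.-homog -> bihomog r b w ->
  form_act al be f w = act_term al be r b c f w.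
Proof.
move=> f_c w_rb.
have [->|f_neq0] := eqVneq f 0.
  by rewrite act_term0l /form_act msize0 big_ord0.
have [->|w_neq0] := eqVneq w 0.
  rewrite act_term0r /form_act; do 3!(rewrite big1 // => ? _).
  by rewrite bicomp0 act_term0r.
have [I wI_neq0] : exists I, w I != 0.
  apply/existsP; rewrite -negb_forall; apply: contra w_neq0 => /forallP w0.
  by apply/eqP/ffunP => I; rewrite ffunE; apply/eqP/w0.
have [[cI] _] : #|I|%:Z = r /\ (mdeg (mlead (w I)) + #|I|)%N%:Z = b.
  by apply: w_rb; rewrite mleadc_eq0.
have lt_r : (r < n.+1)%N.
  by rewrite ltnS -cI -[leqRHS]card_ord max_card.
pose p := maxn (msize f) c.+1; pose q := maxn (deg_bound w) b.+1.
rewrite (@form_actwE _ _ _ _ p q) ?leq_maxl //.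
have lt_c : (c < p)%N by rewrite leq_maxr.
have lt_b : (b < q)%N by rewrite leq_maxr.
have termE c' r' b' :
    act_term al be r' b' c' (pihomog mdeg c' f) (bicomp r' b' w)
    = if [&& c' == c, r' == r & b' == b] then act_term al be r b c f w else 0.
  rewrite (bicomp_homog _ _ w_rb) [r' == r]eq_sym [b' == b]eq_sym.
  have [->|neq_c] := eqVneq c' c; last first.
    by rewrite (pihomog_ne0 _ f_c) ?act_term0l // eq_sym.
  rewrite pihomog_dE //; case: eqP => [->|_]; last exact: act_term0r.
  by case: eqP => [->|_] //; exact: act_term0r.
pose T c' r' b' := act_term al be r' b' c' (pihomog mdeg c' f) (bicomp r' b' w).
rewrite (@sum_ord_only _ (fun c' => \sum_(r' < n.+1) \sum_(b' < q) T c' r' b')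
           p c lt_c); last first.
  move=> c' neq_c; rewrite big1 // => r' _; rewrite big1 // => b' _.
  by rewrite /T termE (negPf neq_c).
rewrite (@sum_ord_only _ (fun r' => \sum_(b' < q) T c r' b') n.+1 r lt_r);
    last first.
  move=> r' neq_r; rewrite big1 // => b' _.
  by rewrite /T termE (negPf neq_r) andbF.
rewrite (@sum_ord_only _ (T c r) q b lt_b) => [|b' neq_b]; last first.
  by rewrite /T termE (negPf neq_b) !andbF.
by rewrite /T termE !eqxx.
Qed.

End Forms.

(* Main.v *)
(* By induction on the degree b, every monomial form x^m dx_I of degree b + 1
   lies in S(1).Omega^r(b).  For i in I, dx_i /\ i_R(x^m dx_I) = x_i x^m dx_I, so
   x_i acts on x^m dx_I as multiplication by (alpha + beta) x_i, and
   alpha + beta <> 0: this reaches all x^m dx_I such that some x_i with i in I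
   divides x^m.  Otherwise, as b + 1 > n + 1, some x_k^2 with k not in I divides
   x^m.  Modulo the forms already reached, both alpha * x^m dx_I (by the action
   of x_k on x^m / x_k dx_I) and, if r > 0, beta * x^m dx_I (by the action of x_i
   on x^m / x_k dx_(I - i + k), for i in I) are in S(1).Omega^r(b), and alpha or
   beta is nonzero. *)
Require Import Defs.
From mathcomp Require Import all_boot all_order all_algebra.
From mathcomp Require Import reals.
From mathcomp Require Import complex mpoly.
From mathcomp Require Import zify.

Set Implicit Arguments.
Unset Strict Implicit.
Unset Printing Implicit Defensive.

Import Order.TTheory GRing.Theory Num.Theory.

Local Open Scope ring_scope.
Local Open Scope complex_scope.

Section Forms.
Variables (R : realType) (n : nat).
Local Notation S := {mpoly R[i][n]}.
Local Notation Omega := (diff_form R n).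

(** * Compatibility of the action with complex scalars and finite sums *)

Lemma scale_formZl (k : R[i]) (f : S) w :
  scale_form (k *: f) w = k *: scale_form f w.
Proof. by apply/ffunP => I; rewrite !ffunE scalerAl. Qed.

Lemma wedgeZl (k : R[i]) (u v : Omega) : wedge (k *: u) v = k *: wedge u v.
Proof.
apply/ffunP => K; rewrite !ffunE scaler_sumr; apply: eq_bigr => I _.
by rewrite ffunE -scalerAl -scalerAr.
Qed.

Lemma wedgeZr (k : R[i]) (u v : Omega) : wedge u (k *: v) = k *: wedge u v.
Proof.
apply/ffunP => K; rewrite !ffunE scaler_sumr; apply: eq_bigr => I _.
by rewrite ffunE -!scalerAr.
Qed.

Lemma form0Z (k : R[i]) (f : S) : form0 (k *: f) = k *: form0 f.
Proof. by apply/ffunP => I; rewrite !ffunE scalerMnr. Qed.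

Lemma ext_dZ (k : R[i]) (w : Omega) : ext_d (k *: w) = k *: ext_d w.
Proof.
rewrite /ext_d scaler_sumr; apply: eq_bigr => i _; rewrite -wedgeZr.
by congr wedge; apply/ffunP => I; rewrite !ffunE mderivZ.
Qed.

Lemma act_termZl al be r b c (k : R[i]) (f : S) w :
  act_term al be r b c (k *: f) w = k *: act_term al be r b c f w.
Proof.
rewrite /act_term scale_formZl form0Z ext_dZ wedgeZl scalerDr !scalerA.
by rewrite ![_ * k]mulrC.
Qed.

Lemma form_actZl al be (k : R[i]) (f : S) w :
  form_act al be (k *: f) w = k *: form_act al be f w.
Proof.
rewrite (form_actwE _ _ (msizeZ_le f k) (leqnn (deg_bound w))) scaler_sumr.
do 3!(apply: eq_bigr => ? _; rewrite ?scaler_sumr).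
by rewrite linearZ act_termZl.
Qed.

Lemma form_act0l al be (w : Omega) : form_act al be (0 : S) w = 0.
Proof. by rewrite /form_act msize0 big_ord0. Qed.

Lemma form_act0r al be (f : S) : form_act al be f (0 : Omega) = 0.
Proof. by apply: (addrI (form_act al be f 0)); rewrite -form_actDr !addr0. Qed.

Lemma form_act_sumr al be (f : S) (T : finType) (F : T -> Omega) :
  form_act al be f (\sum_t F t) = \sum_t form_act al be f (F t).
Proof. exact: (big_morph _ (form_actDr al be f) (form_act0r al be f)). Qed.

(** * Exterior multiplication by dx_i *)

Lemma wedge_dxE (i : 'I_n) (v : Omega) K :
  wedge (dx R i) v K = if i \in K
    then (-1) ^+ #|[set j in K :\ i | (j < i)%N]| * v (K :\ i) else 0.
Proof.
rewrite ffunE; case: ifPn => iK; last first.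
  rewrite big1 // => I IK; rewrite ffunE; case: eqP => [E|_].
    by move: IK; rewrite E sub1set (negPf iK).
  by rewrite mul0r mulr0.
rewrite (bigD1 [set i]) ?sub1set //= big1 ?addr0; last first.
  by move=> I /andP[_ /negPf nI]; rewrite ffunE nI mul0r mulr0.
rewrite ffunE eqxx mul1r; congr ((-1) ^+ _ * _).
(* The inversions of {i} against K - i are the pairs (i, j) with j < i, in bijection with these
   j. *)
have pair_inj : injective (pair i : 'I_n -> _) by move=> x y [].
rewrite /inversions -(card_imset _ pair_inj).
apply: eq_card => -[x y]; rewrite !inE /=; apply/idP/imsetP.
  move=> /and3P[/eqP -> yK lt_y]; exists y => //.
  by rewrite !inE yK lt_y.
by case=> z; rewrite !inE => /andP[zK lt_z] [-> ->]; rewrite eqxx zK.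
Qed.

Lemma ext_d_form0X (i : 'I_n) : ext_d (form0 ('X_i : S)) = dx R i.
Proof.
rewrite /ext_d (bigD1 i) //= big1 ?addr0.
  apply/ffunP => K; rewrite wedge_dxE !ffunE mderivMn mderivX mnm1E eqxx.
  have -> : (U_(i) - U_(i) = 0 :> 'X_{1..n})%MM.
    by apply/mnmP => j; rewrite mnmBE mnm0E subnn.
  rewrite scale1r mpolyX0.
  have [->|neqK] := eqVneq K [set i].
    by rewrite set11 setDv !eqxx eq_card0 ?mul1r // => j; rewrite !inE.
  case: ifP => // iK; have [K0|_] := eqVneq; last by rewrite mulr0.
  by case/eqP: neqK; rewrite -(setD1K iK) K0 setU0.
move=> j neq_ji; apply/ffunP => K; rewrite wedge_dxE !ffunE mderivMn mderivX.
by rewrite mnm1E eq_sym (negPf neq_ji) scale0r mul0rn mulr0 if_same.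
Qed.

(** * Monomial forms x^m dx_I and the action of a variable on them *)

Definition mono (I : {set 'I_n}) (m : 'X_{1..n}) : Omega :=
  [ffun J => 'X_[m] *+ (J == I)].

Lemma mono_expansion (w : Omega) :
  w = \sum_I \sum_(m <- msupp (w I)) (w I)@_m *: mono I m.
Proof.
apply/ffunP => J; rewrite sum_ffunE (bigD1 J) //=
  [X in _ + X]big1 ?addr0; last first.
  move=> I neqI; rewrite sum_ffunE big1 // => m _.
  by rewrite !ffunE eq_sym (negPf neqI) scaler0.
rewrite sum_ffunE {1}[w J]mpolyE; apply: eq_bigr => m _.
by rewrite !ffunE eqxx.
Qed.

Lemma mono_coeff I m J m' : (mono I m J)@_m' != 0 -> I = J /\ m = m'.
Proof.
rewrite ffunE mcoeffMn mcoeffX; case: (J =P I) => [->|_]; last by rewrite eqxx.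
by case: (m =P m') => [->|_] //; rewrite mulr0n eqxx.
Qed.

Lemma mono_bihomog (I : {set 'I_n}) (m : 'X_{1..n}) :
  bihomog #|I| (mdeg m + #|I|)%N (mono I m).
Proof. by move=> J m' /mono_coeff[-> ->]. Qed.

(** [wedge] and [contract] carry their signs as polynomials, while combinations of monomial forms
    carry them as complex scalars. *)
Lemma sign_scaleE k (f : S) : ((-1) ^+ k : R[i]) *: f = (-1) ^+ k * f.
Proof. by rewrite -signr_odd -[in RHS]signr_odd scaler_sign mulr_sign. Qed.

Lemma contract_mono (I : {set 'I_n}) (m : 'X_{1..n}) :
  contract (@radial R n) (mono I m)
  = \sum_(k in I) (-1) ^+ #|[set j in I :\ k | (j < k)%N]|
      *: mono (I :\ k) (m + U_(k)).
Proof.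
apply/ffunP => L; rewrite ffunE sum_ffunE.
rewrite [LHS]big_mkcond [RHS]big_mkcond /=; apply: eq_bigr => k _.
(* For k outside L, the summand at L is nonzero only if L + k = I, that is, k is in I and L = I -
   k. *)
rewrite ffunE; case: ifPn => kL.
  have [<-|neq] := eqVneq; last first.
    rewrite mulr0 mulr0; case: ifP => // kI; rewrite !ffunE.
    case: eqP => [E|_]; last by rewrite scaler0.
    by rewrite E setD1K ?eqxx in neq.
  by rewrite setU11 !ffunE setU1K // eqxx mulr1n addmC mpolyXD sign_scaleE.
case: ifP => // kI; rewrite !ffunE; case: eqP => [E|_]; last by rewrite scaler0.
by rewrite E !inE eqxx in kL.
Qed.

Lemma wedge_dx_mono i (I : {set 'I_n}) (m : 'X_{1..n}) :
  wedge (dx R i) (mono I m) = if i \in I then 0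
  else (-1) ^+ #|[set j in I | (j < i)%N]| *: mono (i |: I) m.
Proof.
apply/ffunP => K; rewrite wedge_dxE ffunE; case: ifPn => iK.
  have [<-|neq] := eqVneq.
    by rewrite setD11 !ffunE setD1K // eqxx mulr1n sign_scaleE.
  rewrite mulr0; case: ifPn => iI; first by rewrite ffunE.
  rewrite !ffunE; case: eqP => [E|_]; last by rewrite scaler0.
  by rewrite E setU1K ?eqxx in neq.
case: ifPn => iI; first by rewrite ffunE.
rewrite !ffunE; case: eqP => [E|_]; last by rewrite scaler0.
by rewrite E setU11 in iK.
Qed.

Lemma wedge_dx_sum i (A : {pred 'I_n}) (F : 'I_n -> Omega) :
  wedge (dx R i) (\sum_(k in A) F k) = \sum_(k in A) wedge (dx R i) (F k).
Proof.
apply: (big_morph _ (wedgeDr (dx R i))).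
by apply: (addrI (wedge (dx R i) 0)); rewrite -wedgeDr !addr0.
Qed.

(** Only the term of the contraction that omits dx_i survives the wedge. Removing and restoring dx_i
    give the same sign, whose square is 1. *)
Lemma euler_mono_in i (I : {set 'I_n}) (m : 'X_{1..n}) : i \in I ->
  wedge (dx R i) (contract (@radial R n) (mono I m)) = mono I (m + U_(i)).
Proof.
move=> iI; rewrite contract_mono wedge_dx_sum (bigD1 i) //= big1 ?addr0.
  by rewrite wedgeZr wedge_dx_mono !inE eqxx /= setD1K // scalerA -expr2
    sqrr_sign scale1r.
move=> k /andP[kI neq]; rewrite wedgeZr wedge_dx_mono !inE iI eq_sym neq /=.
by rewrite scaler0.
Qed.

(** No dx_i occurs in dx_I, so every term of the contraction survives. The exponents s stay
    abstract: what matters is that the signs are invertible scalars. *)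
Lemma euler_mono_out i (I : {set 'I_n}) (m : 'X_{1..n}) : i \notin I ->
  exists s : 'I_n -> nat, wedge (dx R i) (contract (@radial R n) (mono I m))
    = \sum_(k in I) (-1) ^+ s k *: mono (i |: I :\ k) (m + U_(k)).
Proof.
move=> iI; exists (fun k => #|[set j in I :\ k | (j < k)%N]|
                      + #|[set j in I :\ k | (j < i)%N]|)%N.
rewrite contract_mono wedge_dx_sum; apply: eq_bigr => k kI.
by rewrite wedgeZr wedge_dx_mono !inE (negPf iI) andbF scalerA -exprD.
Qed.

Lemma scale_formX_mono i (I : {set 'I_n}) (m : 'X_{1..n}) :
  scale_form ('X_i : S) (mono I m) = mono I (m + U_(i)).
Proof. by apply/ffunP => J; rewrite !ffunE mpolyXD mulrC mulrnAl. Qed.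

Lemma ext_d_form0C (c : R[i]) : ext_d (form0 (c%:MP : S)) = 0.
Proof.
rewrite /ext_d big1 // => i _; apply/ffunP => K; rewrite wedge_dxE !ffunE.
by rewrite mderivMn mderivC mul0rn mulr0 if_same.
Qed.

(** Since d1 = 0, the beta term vanishes, and alpha is normalized at c = 0. *)
Lemma form_act1 al be (r b : nat) (w : Omega) : al r b 0%N = 1 ->
  bihomog r b w -> form_act al be 1 w = w.
Proof.
move=> al1 w_rb; rewrite (form_act_homog (c := 0%N) _ _ _ w_rb) ?dhomog1 //.
rewrite /act_term al1 scale1r -mpolyC1 ext_d_form0C.
have -> : wedge 0 (contract (@radial R n) w) = 0.
  apply/ffunP => K; rewrite !ffunE big1 // => I _.
  by rewrite ffunE mul0r mulr0.
by rewrite scaler0 addr0; apply/ffunP => I; rewrite ffunE mpolyC1 mul1r.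
Qed.

Lemma form_actX_mono al be i (I : {set 'I_n}) (m : 'X_{1..n}) (r b : nat) :
  #|I| = r -> (mdeg m + r)%N = b ->
  form_act al be ('X_i : S) (mono I m) = al r b 1%N *: mono I (m + U_(i))
    + be r b 1%N *: wedge (dx R i) (contract (@radial R n) (mono I m)).
Proof.
move=> cI mb; have mono_rb : bihomog r b (mono I m).
  by rewrite -mb -cI; exact: mono_bihomog.
rewrite (form_act_homog (c := 1%N) _ _ _ mono_rb).
  by rewrite /act_term scale_formX_mono ext_d_form0X.
by rewrite dhomogX /= mdeg1.
Qed.

Lemma bihomog_trunc nr (r b : nat) (w : Omega) :
  (nr r <= b)%N -> bihomog r b w -> trunc nr w.
Proof. by move=> nrb w_rb I m /w_rb[[->] [->]]. Qed.

(** * The S-span of a finite family under the twisted action *)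

Section Generation.
Variables (nr : nat -> nat) (al be : nat -> nat -> nat -> R[i]).
Variables (T : finType) (g : T -> Omega).

Definition generated (w : Omega) : Prop :=
  exists f : T -> S, w = \sum_t form_act al be (f t) (g t).

Lemma generated0 : generated 0.
Proof. by exists (fun=> 0); rewrite big1 // => t _; rewrite form_act0l. Qed.

Lemma generatedD v w : generated v -> generated w -> generated (v + w).
Proof.
move=> [f ->] [h ->]; exists (fun t => f t + h t).
by rewrite -big_split; apply: eq_bigr => t _; rewrite form_actDl.
Qed.

Lemma generatedZ (k : R[i]) w : generated w -> generated (k *: w).
Proof.
move=> [f ->]; exists (fun t => k *: f t).
by rewrite scaler_sumr; apply: eq_bigr => t _; rewrite form_actZl.
Qed.

Lemma generatedB v w : generated v -> generated w -> generated (v - w).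
Proof. by move=> gv gw; rewrite -scaleN1r; apply/generatedD/generatedZ. Qed.

Lemma generated_sum (I : eqType) (s : seq I) (P : pred I) (F : I -> Omega) :
  (forall i, i \in s -> P i -> generated (F i)) ->
  generated (\sum_(i <- s | P i) F i).
Proof.
move=> gF; rewrite big_seq_cond.
apply: big_ind => [||i /andP[]]; last exact: gF.
  exact: generated0.
exact: generatedD.
Qed.

Lemma generated_gen t : form_act al be 1 (g t) = g t -> generated (g t).
Proof.
move=> g1; exists (fun u => (u == t)%:R); rewrite (bigD1 t) //= eqxx g1.
by rewrite big1 ?addr0 // => u /negPf->; rewrite form_act0l.
Qed.

(** Condition (c) turns h.(f.g_t) into (h f).g_t. It is assumed only on the truncation, whence the
    hypothesis on the g_t. *)
Lemma generated_act (D : Omega -> Omega) h w :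
  is_action nr D al be -> (forall t, trunc nr (g t)) ->
  generated w -> generated (form_act al be h w).
Proof.
move=> act g_trunc [f ->]; exists (fun t => h * f t).
by rewrite form_act_sumr; apply: eq_bigr => t _; rewrite (action_c act).
Qed.

Lemma generated_finitely (M G : Omega -> Prop) :
  (forall t, G (g t)) -> (forall w, M w -> generated w) ->
  finitely_generated_in (form_act al be) M G.
Proof.
move=> Gg Mg; exists #|T|, (fun i => g (enum_val i)); split=> // w /Mg[f ->].
exists (fun i => f (enum_val i)).
by rewrite (reindex _ (onW_bij _ (enum_val_bij T))).
Qed.

End Generation.

(** * Passage from degree b to degree b + 1, with [gen_b] as induction hypothesis *)

Section MonomialGeneration.
Variables (nr : nat -> nat) (D : Omega -> Omega).
Variables (al be : nat -> nat -> nat -> R[i]).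
Variables (T : finType) (g : T -> Omega) (r b : nat).
Hypotheses (act : is_action nr D al be) (g_trunc : forall t, trunc nr (g t)).
Hypothesis (ab_neq0 : al r b 1%N + be r b 1%N != 0).
Hypothesis gen_b : forall (I : {set 'I_n}) (m : 'X_{1..n}),
  #|I| = r -> (mdeg m + r)%N = b -> generated al be g (mono I m).

Lemma generated_mono_mul_in (I : {set 'I_n}) (m : 'X_{1..n}) i :
  #|I| = r -> (mdeg m + r)%N = b -> i \in I ->
  generated al be g (mono I (m + U_(i))).
Proof.
move=> cI mb iI.
have := generated_act 'X_i act g_trunc (gen_b cI mb).
rewrite (form_actX_mono _ _ _ cI mb) euler_mono_in // -scalerDl.
by move/(generatedZ (al r b 1%N + be r b 1%N)^-1); rewrite scalerA mulVf ?scale1r.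
Qed.

(** Regrouping x_i x^m as x_k (x_i x^m / x_k) reduces to multiplication by a variable x_k with k in
    I. *)
Lemma generated_mono_mul_meet (I : {set 'I_n}) (m : 'X_{1..n}) i k :
  #|I| = r -> (mdeg m + r)%N = b -> k \in I -> (0 < m k)%N ->
  generated al be g (mono I (m + U_(i))).
Proof.
move=> cI mb kI mk_gt0.
have Um : (U_(k) <= m)%MM by rewrite lep1mP -lt0n.
have -> : (m + U_(i) = (m - U_(k) + U_(i)) + U_(k))%MM.
  by rewrite -addmA (addmC U_(i)%MM) addmA submK.
apply: generated_mono_mul_in => //.
by rewrite -mb -[in RHS](submK Um) !mdegD !mdeg1.
Qed.

(* If I misses the variable x_k, then x_k acts on x^m dx_I as [al * x_k x^m dx_I]
   up to forms whose monomial part meets their dx part as soon as x_k | x^m. *)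
Lemma generated_al (I : {set 'I_n}) (m : 'X_{1..n}) k :
  #|I| = r -> (mdeg m + r)%N = b -> k \notin I -> (0 < m k)%N ->
  generated al be g (al r b 1%N *: mono I (m + U_(k))).
Proof.
move=> cI mb kI mk_gt0; have := generated_act 'X_k act g_trunc (gen_b cI mb).
rewrite (form_actX_mono _ _ _ cI mb); have [s ->] := euler_mono_out m kI.
set u := be r b 1%N *: _ => gen_sum; rewrite -[_ *: mono _ _](addrK u).
apply/generatedB/generatedZ/generated_sum => // l _ lI; apply: generatedZ.
(* Each term of the contraction now contains dx_k, and x_k divides x^m. *)
apply: (@generated_mono_mul_meet _ _ _ k); rewrite ?setU11 //.
by rewrite cardsU1 !inE (negPf kI) andbF -cI (cardsD1 l I) lI.
Qed.

(* Applying x_i to x^m dx_(I - i + k) recovers [be * x_k x^m dx_I]. *)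
Lemma generated_be (I : {set 'I_n}) (m : 'X_{1..n}) i k :
  #|I| = r -> (mdeg m + r)%N = b -> i \in I -> k \notin I -> (0 < m k)%N ->
  generated al be g (be r b 1%N *: mono I (m + U_(k))).
Proof.
move=> cI mb iI kI mk_gt0; pose J := k |: I :\ i.
have neq_ik : i != k by apply: contraNneq kI => <-.
have cJ : #|J| = r by rewrite cardsU1 !inE (negPf kI) andbF -cI (cardsD1 i I) iI.
have iJ : i \notin J by rewrite !inE eqxx orbF.
have kJ : k \in J by rewrite setU11.
have JkE : i |: J :\ k = I by rewrite setU1K ?setD1K // !inE (negPf kI) andbF.
have := generated_act 'X_i act g_trunc (gen_b cJ mb).
rewrite (form_actX_mono _ _ _ cJ mb); have [s ->] := euler_mono_out m iJ.
(* The term omitting dx_k gives back dx_I; every other term, like the alpha term u, keeps dx_k while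
   x_k divides x^m. *)
rewrite (bigD1 k) //= JkE scalerDr.
set u := _ *: mono J _; set w := _ *: (_ *: mono I _).
set v := be r b 1%N *: _ => gen_sum.
have gen_u : generated al be g u.
  by apply/generatedZ/(generated_mono_mul_meet _ cJ mb kJ).
have gen_v : generated al be g v.
  apply/generatedZ/generated_sum => l _ /andP[lJ neq_lk]; apply: generatedZ.
  apply: (@generated_mono_mul_meet _ _ _ k) => //.
    by rewrite cardsU1 in_setD1 (negPf iJ) andbF -cJ (cardsD1 l J) lJ.
  by rewrite in_setU1 in_setD1 (eq_sym k l) neq_lk kJ orbT.
have gen_w : generated al be g w.
  rewrite (_ : w = (u + (w + v)) - u - v); last by rewrite [u + _]addrC !addrK.
  by do 2!apply: generatedB => //.
have /(generatedZ ((-1) ^+ s k)) := gen_w.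
by rewrite /w !scalerA mulrCA -expr2 sqrr_sign mulr1.
Qed.

Lemma generated_mono_step (I : {set 'I_n}) (m : 'X_{1..n}) :
  (n < b)%N -> (r = 0%N -> be r b 1%N = 0) ->
  #|I| = r -> (mdeg m + r)%N = b.+1 -> generated al be g (mono I m).
Proof.
move=> lt_nb be0 cI mb.
have decomp k : (0 < m k)%N ->
    exists2 m' : 'X_{1..n}, (m = m' + U_(k))%MM & (mdeg m' + r)%N = b.
  move=> mk; have Um : (U_(k) <= m)%MM by rewrite lep1mP -lt0n.
  exists (m - U_(k))%MM; first by rewrite submK.
  by move: mb; rewrite -{1}(submK Um) mdegD mdeg1; lia.
have [/exists_inP[i iI mi]|] := boolP [exists i in I, (0 < m i)%N].
  by have [m' -> m'b] := decomp i mi; exact: generated_mono_mul_in.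
rewrite negb_exists_in => /forall_inP m0.
(* Pigeonhole: if all exponents are at most 1 and vanish on I, then |m| <= n - r, against |m| + r =
   b + 1 > n. *)
have [k mk] : exists k, (1 < m k)%N.
  apply/existsP; rewrite -[[exists k, _]]negbK negb_exists.
  apply/negP => /forallP m_le1.
  have : (mdeg m <= #|~: I|)%N.
    rewrite mdegE -sum1_card [leqRHS]big_mkcond /=; apply: leq_sum => i _.
    rewrite inE; case: ifPn => [_|]; first by rewrite leqNgt m_le1.
    by rewrite negbK => /m0; rewrite -eqn0Ngt => /eqP->.
  by have := cardsC I; rewrite card_ord cI; lia.
have kI : k \notin I by apply/negP => /m0; rewrite (ltnW mk).
have [m' mE m'b] := decomp k (ltnW mk).
(* As x_k^2 divides x^m, one factor x_k remains in x^m', as [generated_al] and [generated_be]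
   require. *)
have m'k : (0 < m' k)%N by move: mk; rewrite mE mnmDE mnm1E eqxx; lia.
have inv (c : R[i]) : c != 0 -> generated al be g (c *: mono I m) ->
    generated al be g (mono I m).
  by move=> c0 /(generatedZ c^-1); rewrite scalerA mulVf ?scale1r.
have [al0|al_neq0] := eqVneq (al r b 1%N) 0; last first.
  by apply: inv al_neq0 _; rewrite mE; exact: generated_al.
have be_neq0 : be r b 1%N != 0 by move: ab_neq0; rewrite al0 add0r.
(* Here beta is nonzero, so [be0] excludes r = 0 and I is nonempty. *)
have [i iI] : exists i, i \in I.
  apply/set0Pn; rewrite -card_gt0 cI lt0n.
  by apply: contraNneq be_neq0 => /be0 ->.
by apply: inv be_neq0 _; rewrite mE; exact: generated_be iI _ _.
Qed.

End MonomialGeneration.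

End Forms.

(** * Generation by the monomial forms of lowest degree *)

Theorem proposition3p2 (R : realType) (n : nat) (nr : nat -> nat) (q a : int)
    (D : diff_form R n -> diff_form R n) (alpha beta : nat -> nat -> nat -> R[i])
    (r : nat)
    (hr : (r <= n)%N)
    (hD : is_Diff nr q a D)
    (hact : is_action nr D alpha beta)
    (hnr : (n < nr r)%N)
    (hbeta0 : r = 0%N -> forall b : nat, (nr r <= b)%N -> beta r b 1%N = 0)
    (hne : forall b : nat, (nr r <= b)%N ->
      alpha r b 1%N ^+ 2 - beta r b 1%N ^+ 2 != 0) :
  finitely_generated_in (form_act alpha beta)
    (fun w : diff_form R n => trunc nr w /\ is_rform r w)
    (bihomog r (nr r)).
Proof.
pose N := nr r.
(* Bounding |m| by N makes the index type finite. Indices of the wrong bidegree receive the form 0,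
   which is bihomogeneous of every bidegree. *)
pose ok (t : {set 'I_n} * 'X_{1..n < N.+1}) :=
  (#|t.1| == r) && (mdeg t.2 + r == N)%N.
pose g t : diff_form R n := if ok t then mono R t.1 t.2 else 0.
have g_homog t : bihomog r N (g t).
  rewrite /g; case: ifP => [/andP[/eqP cI /eqP mN]|_].
    by have := @mono_bihomog R n t.1 t.2; rewrite cI mN.
  by move=> I m; rewrite ffunE mcoeff0 eqxx.
have g_trunc t : trunc nr (g t) by exact: bihomog_trunc (g_homog t).
apply: (generated_finitely (g := g)) => // w [w_trunc w_r].
(* It suffices to treat the monomial forms in the expansion of w; they have degree at least N
   because w lies in the truncation. *)
suff gen b (I : {set 'I_n}) (m : 'X_{1..n}) : (N <= b)%N -> #|I| = r ->
    (mdeg m + r)%N = b -> generated alpha beta g (mono R I m).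
  rewrite [w]mono_expansion; apply: generated_sum => I _ _.
  apply: generated_sum => m; rewrite mcoeff_msupp => wIm _; apply: generatedZ.
  have cI : #|I| = r by apply: w_r; apply: contraNneq wIm => ->; rewrite mcoeff0.
  by apply: gen (erefl) => //; rewrite /N -cI; exact: w_trunc.
(* Degree 0 is excluded by n < N. In degree b + 1, either N = b + 1, the base case, or N <= b, the
   inductive step. *)
elim: b I m => [|b IHb] I m; first by move=> /(leq_trans hnr).
rewrite leq_eqVlt => /predU1P[Nb|lt_Nb] cI mb; last first.
  apply: (@generated_mono_step R n nr D alpha beta _ g r b) => //.
  (* alpha + beta is a factor of alpha^2 - beta^2. *)
  - by apply: contraNneq (hne b lt_Nb) => ab0; rewrite subr_sqr ab0 mulr0.
  - by move=> J m' cJ m'b; exact: IHb.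
  - exact: leq_trans hnr _.
  - by move=> r0; exact: hbeta0.
(* Base case: x^m dx_I is itself a generator. The strict bound N + 1 admits |m| = N, reached when r
   = 0. *)
have lt_m : (mdeg m < N.+1)%N by rewrite ltnS Nb -mb leq_addr.
pose t := (I, BMultinom lt_m).
have gE : g t = mono R I m by rewrite /g /ok /= cI mb Nb !eqxx.
rewrite -gE; apply: generated_gen.
exact: form_act1 (action_a hact r N) (g_homog t).
Qed.
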